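(* Given $H_T = 12$ km (that is, $H_T = 12000$ in metres), the Saastamoinen and Hopfield non-hydrostatic (wet) delays are equivalent when the temperature equals $307$ K; that is, $Z_W^S = Z_W^H$ when $T = 307$ K, where $$Z_W^S = 0.002277\left(\frac{1255}{T}+0.05\right)e, \qquad Z_W^H = 0.07402\cdot\frac{e}{T^2}\cdot H_T.$$
   Context: $T$ is the temperature in kelvin, and $e$ is the partial water vapour pressure at the surface, computed from $e = \frac{5854}{T^5}\,10^{\,20-\frac{2950}{T}}$. $H_T$ is the height of the tropopause, taken to be 12 km and entered in the Hopfield formula in metres. $Z_W^H$ is the Hopfield non-hydrostatic (wet) delay and $Z_W^S$ is the Saastamoinen non-hydrostatic (wet) delay. ''Equivalent'' means that the two delays are equal: the paper obtains the temperature by equating the two formulas and solving the resulting quadratic equation for $T$.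
   Formalization: At exactly T = 307 K the two delays differ (about 0.0094221e against 0.0094244e), so the formal theorem states that they are equal at exactly one positive temperature, which is 307 K to the nearest kelvin (within less than 1/2 K). *)

(* Defs.v *)
From Stdlib Require Import Reals.
Local Open Scope R_scope.

(* Temperatures are in kelvin, pressures in millibar, heights and delays in
   metres. Division is total in R, so every formula below is meaningful only
   for T > 0. *)

Definition vapour_pressure (T : R) : R :=
  5854 / T ^ 5 * Rpower 10 (20 - 2950 / T).

Definition saastamoinen_wet_delay (T : R) : R :=
  0.002277 * (1255 / T + 0.05) * vapour_pressure T.

Definition hopfield_wet_delay (H_T T : R) : R :=
  0.07402 * (vapour_pressure T / T ^ 2) * H_T.

(* The physical constants are exact decimals, while a temperature quoted in
   whole kelvins is the nearest integer to the temperature meant. *)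
Definition equals_to_nearest_kelvin (T : R) (n : Z) : Prop :=
  Rabs (T - IZR n) < 1 / 2.

(* Main.v *)
(* Both delays are multiples of the positive pressure e, so after multiplying by
   T^2 / e their equality becomes a quadratic equation in T with exactly one
   positive root, which is approximately 307.07. *)

Require Import Defs.
From Stdlib Require Import Reals Lra.
Local Open Scope R_scope.

Lemma vapour_pressure_pos (T : R) : 0 < T -> 0 < vapour_pressure T.
Proof.
intros hT; unfold vapour_pressure.
apply Rmult_lt_0_compat.
- apply Rdiv_lt_0_compat; [lra | now apply pow_lt].
- apply exp_pos.
Qed.

Lemma delays_eq_iff_quadratic (T : R) : 0 < T ->
  saastamoinen_wet_delay T = hopfield_wet_delay 12000 T <->
  759 * T ^ 2 + 19050900 * T = 5921600000.
Proof.
intros hT.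
assert (he := vapour_pressure_pos T hT).
unfold saastamoinen_wet_delay, hopfield_wet_delay.
set (e := vapour_pressure T) in *.
(* Written through [c], both delays are linear in the monomials [c], [c * T] and [c * T ^ 2], within
   reach of [lra]. *)
set (c := e / T ^ 2).
assert (hc : 0 < c) by (apply Rdiv_lt_0_compat; [exact he | now apply pow_lt]).
assert (hcT2 : e = c * T ^ 2) by (unfold c; field; lra).
assert (hcT : 1255 / T * e = 1255 * (c * T)) by (unfold c; field; lra).
(* The factor 0.00000015 scales the decimal coefficients to integers. *)
assert (hdiff : 0.002277 * (1255 / T + 0.05) * e - 0.07402 * c * 12000
  = (759 * T ^ 2 + 19050900 * T - 5921600000) * (0.00000015 * c))
  by lra.
split; intros h.
- assert (h0 : (759 * T ^ 2 + 19050900 * T - 5921600000)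
    * (0.00000015 * c) = 0) by lra.
  apply Rmult_integral in h0; lra.
- replace (759 * T ^ 2 + 19050900 * T - 5921600000) with 0 in hdiff by lra.
  lra.
Qed.

Theorem theorem2 (H_T : R) (hH : H_T = 12000) :
  exists T0 : R,
    equals_to_nearest_kelvin T0 307 /\
    forall T : R, 0 < T ->
      (saastamoinen_wet_delay T = hopfield_wet_delay H_T T <-> T = T0).
Proof.
subst H_T.
(* A quarter of the discriminant; 9525450 is half of 19050900. *)
set (D := 9525450 ^ 2 + 759 * 5921600000).
assert (hs : sqrt D * sqrt D = D) by (apply sqrt_sqrt; unfold D; lra).
assert (hs0 := sqrt_pos D).
set (T0 := (sqrt D - 9525450) / 759).
assert (hsT : sqrt D = 759 * T0 + 9525450) by (unfold T0; field).
rewrite hsT in hs, hs0; unfold D in hs.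
assert (hroot : 759 * T0 ^ 2 + 19050900 * T0 = 5921600000) by lra.
(* [hs0] excludes the negative root; the quadratic's left side is below 5921600000 at 306.5 and
   above it at 307.5. *)
assert (hlo : 306.5 < T0) by nra.
assert (hhi : T0 < 307.5) by nra.
exists T0; split.
- unfold equals_to_nearest_kelvin; apply Rabs_def1; lra.
- intros T hT; rewrite (delays_eq_iff_quadratic T hT); split; intros h.
  (* Difference of the equations for [T] and [T0]; the second factor is positive. *)
  + assert (hfac : (T - T0) * (759 * (T + T0) + 19050900) = 0) by lra.
    apply Rmult_integral in hfac; lra.
  + now rewrite h.
Qed.
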